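(* Let $a\in(0,1)$, $\rho>0$, $\lambda_i>0$, and let $g_i$ be a positive integer. Let $\bar\lambda_i^{(\ell)}\ge 0$ denote the Kalman estimation error variance along the $i$-th eigenvector at a training time $\ell$, where training times are spaced $g_i$ blocks apart, so that it satisfies the Riccati recursion $$\bar\lambda_i^{(\ell)}=\frac{a^{2g_i}\bar\lambda_i^{(\ell-g_i)}+(1-a^{2g_i})\lambda_i}{\rho\left(a^{2g_i}\bar\lambda_i^{(\ell-g_i)}+(1-a^{2g_i})\lambda_i\right)+1}.$$ Then the limit $\lambda_{i,g_i}^{(\underline{\infty})}:=\lim_{\ell\to\infty}\bar\lambda_i^{(\ell)}$ (taken along the training times $\ell$) satisfies $$\lambda_{i,g_i}^{(\underline{\infty})}=\frac{a^{2g_i}\lambda_{i,g_i}^{(\underline{\infty})}+(1-a^{2g_i})\lambda_i}{\rho\left(a^{2g_i}\lambda_{i,g_i}^{(\underline{\infty})}+(1-a^{2g_i})\lambda_i\right)+1}$$ and is given by $$\lambda_{i,g_i}^{(\underline{\infty})}=\frac{\lambda_i}{\frac{1}{2}(1+\lambda_i\rho)+\sqrt{\left(\frac{1}{2}(1+\lambda_i\rho)\right)^2+\frac{a^{2g_i}}{1-a^{2g_i}}\lambda_i\rho}}.$$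
   Context: A channel vector evolves as $\mathbf{h}_{\ell+1}=a\mathbf{h}_\ell+\sqrt{1-a^2}\,\mathbf{b}_{\ell+1}$ with covariance $\mathbf{R}_{\mathbf{h}}$; $\lambda_i$ is a non-zero eigenvalue of $\mathbf{R}_{\mathbf{h}}$ with unit eigenvector $\mathbf{u}_i$. The training signal $\sqrt{\rho}\,\mathbf{u}_i$ is transmitted once every $g_i$ blocks (unit noise variance), and $\bar\lambda_i^{(\ell)}$ is the eigenvalue, for the eigenvector $\mathbf{u}_i$, of the Kalman estimation error covariance matrix at a block $\ell$ in which $\mathbf{u}_i$ is transmitted. The training times form an arithmetic progression $\ell_0,\ell_0+g_i,\ell_0+2g_i,\dots$. Only the recursion in the claim is needed. *)

(* Defs.v *)
From HB Require Import structures.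
From mathcomp Require Import all_boot all_order all_algebra.
From mathcomp Require Import all_classical all_reals all_analysis.

Set Implicit Arguments.
Unset Strict Implicit.
Unset Printing Implicit Defensive.

Import Order.TTheory GRing.Theory Num.Theory.
Import numFieldNormedType.Exports.

Local Open Scope ring_scope.

Definition training_time (l0 g k : nat) : nat := (l0 + k * g)%N.

(* Error variance along an eigenvector after g blocks of the dynamics
   h' = a h + sqrt (1 - a^2) b without training, starting from variance x:
   lam is the stationary variance, each block maps x to a^2 x + (1 - a^2) lam. *)
Definition predicted_var (R : realType) (a lam : R) (g : nat) (x : R) : R :=
  a ^+ (2 * g) * x + (1 - a ^+ (2 * g)) * lam.

(* Prediction over g blocks followed by the Kalman measurement update for a
   training signal of power rho and unit noise variance. *)
Definition riccati_step (R : realType) (a rho lam : R) (g : nat) (x : R) : R :=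
  predicted_var a lam g x / (rho * predicted_var a lam g x + 1).

(* Main.v *)
(* On nonnegative reals the Riccati map is a contraction with constant
   [a ^+ (2 * g)], so the iterates converge geometrically to any nonnegative
   fixed point.  Writing a fixed point as [lam / D] turns the fixed-point
   equation into a quadratic for [D], whose positive root gives the formula. *)

Require Import Defs.
From HB Require Import structures.
From mathcomp Require Import all_boot all_order all_algebra.
From mathcomp Require Import all_classical all_reals all_analysis.
From mathcomp Require Import ring.

Set Implicit Arguments.
Unset Strict Implicit.
Unset Printing Implicit Defensive.

Import Order.TTheory GRing.Theory Num.Theory.
Import numFieldNormedType.Exports.

Local Open Scope classical_set_scope.
Local Open Scope ring_scope.

Lemma predicted_var_ge0 (R : realType) (a lam : R) (g : nat) (x : R) :
  0 <= a <= 1 -> 0 <= lam -> 0 <= x -> 0 <= predicted_var a lam g x.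
Proof.
move=> /andP[a0 a1] lam0 x0; rewrite /predicted_var.
by rewrite addr_ge0 // mulr_ge0 ?exprn_ge0 // subr_ge0 exprn_ile1.
Qed.

(** Over the common denominator the products of the two predicted variances cancel, which leaves
    [a ^+ (2 * g) * (x - y)] as numerator. Both denominators are at least 1 because predicted
    variances are nonnegative, so dividing by them cannot increase the distance. *)
Lemma riccati_step_contraction (R : realType) (a rho lam : R) (g : nat)
    (x y : R) :
  0 <= a <= 1 -> 0 <= rho -> 0 <= lam -> 0 <= x -> 0 <= y ->
  `|riccati_step a rho lam g x - riccati_step a rho lam g y|
    <= a ^+ (2 * g) * `|x - y|.
Proof.
move=> a01 rho0 lam0 x0 y0; have /andP[a0 _] := a01.
have px := predicted_var_ge0 g a01 lam0 x0.
have py := predicted_var_ge0 g a01 lam0 y0.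
have dx1 : 1 <= rho * predicted_var a lam g x + 1.
  by rewrite lerDr mulr_ge0.
have dy1 : 1 <= rho * predicted_var a lam g y + 1.
  by rewrite lerDr mulr_ge0.
have dx0 := lt_le_trans ltr01 dx1.
have dy0 := lt_le_trans ltr01 dy1.
have -> : riccati_step a rho lam g x - riccati_step a rho lam g y =
    a ^+ (2 * g) * (x - y) / ((rho * predicted_var a lam g x + 1)
                              * (rho * predicted_var a lam g y + 1)).
  move: (lt0r_neq0 dx0) (lt0r_neq0 dy0).
  rewrite /riccati_step /predicted_var => nx ny.
  by field; rewrite nx ny.
rewrite normrM normrM (ger0_norm (exprn_ge0 _ a0)) ler_piMr //.
  by rewrite mulr_ge0 // exprn_ge0.
by rewrite normfV gtr0_norm ?mulr_gt0 // invf_le1 ?mulr_gt0 // mulr_ege1.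
Qed.

(** After clearing the denominator of the Riccati map, the defect of the fixed-point equation at
    [lam / D] is [lam / D ^+ 2] times the defect of the quadratic equation in [D]. *)
Lemma riccati_step_fixpoint (R : realType) (a rho lam D : R) (g : nat) :
  0 <= a <= 1 -> 0 <= rho -> 0 < lam -> 0 < D ->
  (1 - a ^+ (2 * g)) * (D ^+ 2 - (1 + lam * rho) * D)
    = a ^+ (2 * g) * (lam * rho) ->
  riccati_step a rho lam g (lam / D) = lam / D.
Proof.
move=> a01 rho0 lam0 D0 quad; have nD := lt0r_neq0 D0.
have p0 := predicted_var_ge0 g a01 (ltW lam0) (divr_ge0 (ltW lam0) (ltW D0)).
have d0 : rho * predicted_var a lam g (lam / D) + 1 != 0.
  by rewrite gt_eqF // ltr_wpDl // mulr_ge0.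
rewrite /riccati_step; apply: (canLR (mulfK d0)).
rewrite /predicted_var; move: quad; set q := a ^+ _ => quad.
apply/eqP; rewrite -subr_eq0; apply/eqP.
have -> : q * (lam / D) + (1 - q) * lam
    - lam / D * (rho * (q * (lam / D) + (1 - q) * lam) + 1)
    = lam / D ^+ 2 * ((1 - q) * (D ^+ 2 - (1 + lam * rho) * D)
                      - q * (lam * rho)).
  by field.
by rewrite quad subrr mulr0.
Qed.

(** With the fixed point already in hand, each step shrinks the distance to [M] by the factor [q],
    so a geometric sequence dominates it. The contraction bound is restricted to nonnegative
    arguments because the Riccati denominator can vanish at negative ones. *)
Lemma cvg_contraction_iterates (R : realType) (q M : R) (f : R -> R)
    (u : nat -> R) :
  0 <= q < 1 -> 0 <= M -> f M = M ->
  (forall x y, 0 <= x -> 0 <= y -> `|f x - f y| <= q * `|x - y|) ->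
  (forall k, 0 <= u k) -> (forall k, u k.+1 = f (u k)) ->
  u @ \oo --> M.
Proof.
move=> /andP[q0 q1] M0 fM fq u0 uS.
have dist k : `|u k - M| <= `|u 0%N - M| * q ^+ k.
  elim: k => [|k IH]; first by rewrite expr0 mulr1.
  rewrite uS -{1}fM; apply: le_trans (fq _ _ (u0 k) M0) _.
  by rewrite exprS mulrCA ler_wpM2l.
have dist0 : (fun k => `|u 0%N - M| * q ^+ k) @ \oo --> (0 : R).
  by apply: cvg_geometric; rewrite ger0_norm.
apply/cvgrPdist_lt => e e0.
move/cvgrPdist_lt: dist0 => /(_ e e0); apply: filterS => k.
rewrite sub0r normrN (distrC M) => lte.
by apply: le_lt_trans (dist k) (le_lt_trans (ler_norm _) lte).
Qed.

Theorem mainTheorem2 (R : realType) (a rho lam : R) (g l0 : nat)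
    (lambar : nat -> R)
    (a_gt0 : 0 < a) (a_lt1 : a < 1) (rho_gt0 : 0 < rho) (lam_gt0 : 0 < lam)
    (g_gt0 : (0 < g)%N)
    (lambar_ge0 : forall k : nat, 0 <= lambar (training_time l0 g k))
    (lambar_rec : forall k : nat, let l := training_time l0 g k.+1 in
       lambar l = riccati_step a rho lam g (lambar (l - g)%N)) :
  let u : nat -> R := fun k => lambar (training_time l0 g k) in
  let L : R := lim (u @ \oo) in
  [/\ u @ \oo --> L,
      L = riccati_step a rho lam g L
    & L = lam / (2^-1 * (1 + lam * rho)
            + Num.sqrt ((2^-1 * (1 + lam * rho)) ^+ 2
                        + a ^+ (2 * g) / (1 - a ^+ (2 * g)) * (lam * rho)))].
Proof.
move=> u L.
have a01 : 0 <= a <= 1 by rewrite !ltW.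
have q0 : 0 <= a ^+ (2 * g) by rewrite exprn_ge0 // ltW.
(* Positivity of [g] enters here: a zero exponent would give the constant 1, hence no strict
   contraction and a zero divisor in the formula. *)
have q1 : a ^+ (2 * g) < 1 by rewrite exprn_ilt1 ?ltW // muln_eq0 -lt0n.
have q1' : 1 - a ^+ (2 * g) != 0 by rewrite subr_eq0 gt_eqF.
set c := 2^-1 * (1 + lam * rho).
set r := a ^+ (2 * g) / (1 - a ^+ (2 * g)) * (lam * rho).
have lr0 : 0 < lam * rho by rewrite mulr_gt0.
have c0 : 0 < c by rewrite mulr_gt0 ?invr_gt0 // addr_gt0.
have r0 : 0 <= r by rewrite mulr_ge0 ?divr_ge0 ?subr_ge0 // ltW.
(* Divided by [1 - a ^+ (2 * g)], the quadratic reads [D ^+ 2 - 2 * c * D = r]; this is its positive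
   root. *)
set D := c + Num.sqrt (c ^+ 2 + r).
have D0 : 0 < D by rewrite ltr_wpDr // sqrtr_ge0.
have quad : (1 - a ^+ (2 * g)) * (D ^+ 2 - (1 + lam * rho) * D)
    = a ^+ (2 * g) * (lam * rho).
  have -> : 1 + lam * rho = 2 * c by rewrite /c; field.
  (* Completing the square: [D - c] is the square root itself. *)
  have -> : D ^+ 2 - 2 * c * D = Num.sqrt (c ^+ 2 + r) ^+ 2 - c ^+ 2.
    by rewrite /D; ring.
  rewrite sqr_sqrtr ?addr_ge0 ?sqr_ge0 // /r.
  by field.
have fixD := riccati_step_fixpoint a01 (ltW rho_gt0) lam_gt0 D0 quad.
have uS k : u k.+1 = riccati_step a rho lam g (u k).
  rewrite /u lambar_rec; congr (riccati_step _ _ _ _ (lambar _)).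
  (* The truncated subtraction of [g] is exact, since [g] is a summand of every training time after
     the first. *)
  by rewrite /training_time mulSn addnCA addKn.
have ucvg : u @ \oo --> lam / D.
  apply: (@cvg_contraction_iterates R (a ^+ (2 * g)) _
            (riccati_step a rho lam g)) => //.
  - by rewrite q0.
  - by rewrite divr_ge0 ?ltW.
  - by move=> x y; apply: riccati_step_contraction; rewrite ?ltW.
(* [lim] is meaningful only for a convergent sequence; [ucvg] supplies the convergence and, limits
   being unique, the value. *)
have LE : L = lam / D by apply: cvg_lim.
by split; rewrite LE.
Qed.
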